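(* For nonnegative integers $k,m$ let $C_{(k,k+m,k+m,k+m)}(q,t)$ be the refined $q,t$-Catalan number defined in the context (with the stated convention when $k=0$). Define the formal power series \[ H(x,y,q,t):=\sum_{k,m\ge 0} C_{(k,k+m,k+m,k+m)}(q,t)\,x^k y^m . \] Then \[ H(x,y,q,t)=\frac{-M}{(1-xq^6)(1-xt^6)(1-xq^3t)(1-xqt^3)(1-xq^2t^2)(1-yq^3)(1-yt^3)(1-yqt)}, \] where \begin{align*} M={}&(q^{13}t^7 + q^7t^{13} + q^{12}t^8 + q^8t^{12} + q^9t^{12} + q^{12}t^9 + q^{11}t^{11} + q^{10}t^{11}+ q^{11}t^{10} + q^9t^{11} + q^{11}t^9 + q^{10}t^{10})x^3y^2 \\ &- (q^{11}t^5 + q^5t^{11} + q^{10}t^6 + q^6t^{10} + q^8t^9 + q^9t^8 + q^7t^9 + q^9t^7 + q^8t^8 - q^7t^8 - q^8t^7 + q^7t^7)x^2y^2 \\ &-(q^7t^4 + q^4t^7 + q^6t^5 + q^5t^6)xy^2\\ &-(q^{12}t^6 + q^6t^{12} + q^8t^{11} + q^{11}t^8 + q^{10}t^8 + q^8t^{10} + q^7t^{11} + q^{11}t^7 + q^7t^{10} + q^{10}t^7 + 2q^9t^9 + q^8t^9 + q^9t^8)x^3y\\ &-(q^{10}t^3 + q^3t^{10} + q^5t^7 + q^7t^5 - q^5t^9 -q^9t^5 + q^4t^9 + q^9t^4 + q^4t^8 + q^8t^4 + q^5t^6 + q^6t^5-q^8t^6 - q^6t^8)x^2y \\ &+(qt^8+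 q^8t + qt^7 + q^7t + q^6t^3 +q^3t^6 + q^4t^5 + q^5t^4 + q^2t^5 + q^5t^2 + 2q^4t^4 + q^5t^3+ q^3t^5 +2q^3t^4 +2q^4t^3 \\ &\qquad + q^7t^2 + q^2t^7 + q^6t^2 + q^2t^6)xy \\ &-(q^2t+qt^2)y\\ &+(q^9t^6 + q^6t^9 + q^8t^7+ q^7t^8 + q^8t^8 )x^3 + (q^7t^3 + q^3t^7 - q^5t^6 - q^6t^5 + q^4t^6 + q^6t^4 + q^5t^5 + q^4t^5 + q^5t^4)x^2 \\ &-(qt^5 + q^5t + q^2t^4 + q^4t^2 + qt^4 + q^4t + q^3t^3 + q^2t^3 + q^3t^2)x - 1 . \end{align*}
   Context: Let $\vec k=(k_1,\dots,k_n)$ be a vector of positive integers and $K=k_1+\dots+k_n$. A $\vec k$-Dyck path is a lattice path from $(0,0)$ to $(K,K)$ of the form $N^{k_1}E^{a_1}N^{k_2}E^{a_2}\cdots N^{k_n}E^{a_n}$, where $N=(0,1)$, $E=(1,0)$, the $a_i$ are nonnegative integers with $a_1+\dots+a_n=K$, and the path never goes below the line $y=x$ (equivalently $a_1+\dots+a_i\le k_1+\dots+k_i$ for all $i$). The segment $N^{k_j}$ is called the $j$-th north step (of length $k_j$); consecutive north steps with an intervening $a_i=0$ are still counted as distinct north steps. The rank of a point $(x,y)$ is $y-x$. The red ranks are $r_j=\sum_{i<j}(k_i-a_i)$, the rank of the starting point of the $j$-th north step, and $\mathrm{area}(D)=r_1+\dots+r_n$. Bounce (Xin–Zhang algorithm):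 let $R$ be an initially empty diagram with columns $1,\dots,n$, column $j$ having $k_j+1$ cells (rows $1,\dots,k_j+1$). Set $i=0$, $P_0=(0,0)$. While $P_i\neq(K,K)$: (1) Let $Q_i$ be the starting point of the (unique) east step of $D$ whose starting point has the same $x$-coordinate as $P_i$; the $y$-coordinate of $P_i$ is $k_1+\dots+k_s$ and that of $Q_i$ is $k_1+\dots+k_{s+v_i}$ for some $v_i\ge 0$ (the number of north steps traversed going vertically from $P_i$ to $Q_i$). (2) Fill the next (leftmost) $v_i$ unfilled columns of $R$: a column $j$ being filled gets entries $i,i+1,\dots,i+k_j$ from top to bottom. (3) Let $h_i$ be the number of cells of $R$ (filled so far) containing the value $i+1$, and set $P_{i+1}=(x(Q_i)+h_i,\,y(Q_i))$. (4) Increase $i$ by $1$. Then $\mathrm{bounce}(D)=\sum_{i\ge 0} i\,v_i$. The refined $q,t$-Catalan number is $C_{\vec k}(q,t)=\sum_{D}q^{\mathrm{area}(D)}t^{\mathrm{bounce}(D)}$, summing over all $\vec k$-Dyck paths. Convention for zero entries appearing in the sum: $C_{(0,m,m,m)}(q,t)$ is interpreted as $C_{(m,m,m)}(q,t)$ for $m>0$ (the zero-length first north step is dropped), and $C_{(0,0,0,0)}(q,t)=1$. *)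

(* Defs.v *)
From HB Require Import structures.
From mathcomp Require Import all_boot all_order all_algebra.
From mathcomp Require Import boolp.

Set Implicit Arguments.
Unset Strict Implicit.
Unset Printing Implicit Defensive.

Import GRing.Theory.

Local Open Scope ring_scope.

(* The ring R[[x, y]]: [coef2 f k m] is the coefficient of x^k y^m in f.      *)

Record fps2 (R : Type) := Fps2 { coef2 :> nat -> nat -> R }.

Lemma fps2P (R : Type) (f g : fps2 R) :
  (forall k m, f k m = g k m) -> f = g.
Proof.
case: f g => [f] [g] /= fg; congr Fps2.
by apply/funext => k; apply/funext => m.
Qed.

HB.instance Definition _ (R : Type) := gen_eqMixin (fps2 R).
HB.instance Definition _ (R : Type) := gen_choiceMixin (fps2 R).

Section Zmodule.
Variable R : zmodType.
Implicit Types f g h : fps2 R.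

Definition fps2_zero : fps2 R := Fps2 (fun _ _ => 0).
Definition fps2_opp f : fps2 R := Fps2 (fun k m => - f k m).
Definition fps2_add f g : fps2 R := Fps2 (fun k m => f k m + g k m).

Fact fps2_addA : associative fps2_add.
Proof. by move=> f g h; apply: fps2P => k m /=; rewrite addrA. Qed.

Fact fps2_addC : commutative fps2_add.
Proof. by move=> f g; apply: fps2P => k m /=; rewrite addrC. Qed.

Fact fps2_add0 : left_id fps2_zero fps2_add.
Proof. by move=> f; apply: fps2P => k m /=; rewrite add0r. Qed.

Fact fps2_addN : left_inverse fps2_zero fps2_opp fps2_add.
Proof. by move=> f; apply: fps2P => k m /=; rewrite addNr. Qed.

HB.instance Definition _ := GRing.isZmodule.Build (fps2 R)
  fps2_addA fps2_addC fps2_add0 fps2_addN.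

Lemma coef2_0 k m : (0 : fps2 R) k m = 0. Proof. by []. Qed.
Lemma coef2N f k m : (- f) k m = - f k m. Proof. by []. Qed.
Lemma coef2D f g k m : (f + g) k m = f k m + g k m. Proof. by []. Qed.
Lemma coef2B f g k m : (f - g) k m = f k m - g k m. Proof. by []. Qed.

Lemma coef2_sum (I : Type) (r : seq I) (P : pred I) (F : I -> fps2 R) k m :
  (\sum_(i <- r | P i) F i) k m = \sum_(i <- r | P i) F i k m.
Proof. by elim/big_rec2: _ => //= i s f _ <-. Qed.

End Zmodule.

Section Ring.
Variable R : comNzRingType.
Implicit Types (f g h : fps2 R) (p r : {poly {poly R}}).

Definition fps2C (c : R) : fps2 R :=
  Fps2 (fun k m => if (k == 0)%N && (m == 0)%N then c else 0).

Definition fps2_mul f g : fps2 R := Fps2 (fun k m =>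
  \sum_(i < k.+1) \sum_(j < m.+1) f i j * g (k - i)%N (m - j)%N).

Definition fps2_agree k m p f :=
  forall i j, (i <= k)%N -> (j <= m)%N -> p`_i`_j = f i j.

Definition fps2_trunc n f : {poly {poly R}} :=
  \poly_(i < n) \poly_(j < n) f i j.

Lemma fps2_truncP k m f : fps2_agree k m (fps2_trunc (k + m).+1 f) f.
Proof.
move=> i j le_ik le_jm; rewrite coef_poly ltnS (leq_trans le_ik) ?leq_addr //.
by rewrite coef_poly ltnS (leq_trans le_jm) ?leq_addl.
Qed.

Lemma fps2_agreeM k m p r f g : fps2_agree k m p f -> fps2_agree k m r g ->
  fps2_agree k m (p * r) (fps2_mul f g).
Proof.
move=> pf rg i j le_ik le_jm; rewrite coefM coef_sum /=.
apply: eq_bigr => a _; rewrite coefM; apply: eq_bigr => b _.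
have le_ai : (a <= i)%N by rewrite -ltnS ltn_ord.
have le_bj : (b <= j)%N by rewrite -ltnS ltn_ord.
have le_ak := leq_trans le_ai le_ik; have le_bm := leq_trans le_bj le_jm.
by rewrite pf // rg // (leq_trans (leq_subr _ _)).
Qed.

Lemma fps2_agreeC k m c : fps2_agree k m c%:P%:P (fps2C c).
Proof.
move=> i j _ _; rewrite /= coefC; case: (i == 0)%N; last by rewrite coef0.
by rewrite coefC.
Qed.

Lemma fps2_agreeD k m p r f g : fps2_agree k m p f -> fps2_agree k m r g ->
  fps2_agree k m (p + r) (f + g).
Proof. by move=> pf rg i j ? ?; rewrite !coefD pf ?rg. Qed.

Lemma fps2_agree_coef k m p f : fps2_agree k m p f -> f k m = p`_k`_m.
Proof. by move->. Qed.

Fact fps2_mulA : associative fps2_mul.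
Proof.
move=> f g h; apply: fps2P => k m.
have [pf pg ph] :=
  And3 (@fps2_truncP k m f) (@fps2_truncP k m g) (@fps2_truncP k m h).
rewrite (fps2_agree_coef (fps2_agreeM pf (fps2_agreeM pg ph))) mulrA.
by rewrite (fps2_agree_coef (fps2_agreeM (fps2_agreeM pf pg) ph)).
Qed.

Fact fps2_mulC : commutative fps2_mul.
Proof.
move=> f g; apply: fps2P => k m.
have [pf pg] := conj (@fps2_truncP k m f) (@fps2_truncP k m g).
rewrite (fps2_agree_coef (fps2_agreeM pf pg)) mulrC.
by rewrite (fps2_agree_coef (fps2_agreeM pg pf)).
Qed.

Fact fps2_mul1 : left_id (fps2C 1) fps2_mul.
Proof.
move=> f; apply: fps2P => k m; have pf := @fps2_truncP k m f.
rewrite (fps2_agree_coef (fps2_agreeM (@fps2_agreeC k m 1) pf)).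
by rewrite !polyC1 mul1r (fps2_agree_coef pf).
Qed.

Fact fps2_mulDl : left_distributive fps2_mul +%R.
Proof.
move=> f g h; apply: fps2P => k m; rewrite coef2D.
have [pf pg ph] :=
  And3 (@fps2_truncP k m f) (@fps2_truncP k m g) (@fps2_truncP k m h).
rewrite (fps2_agree_coef (fps2_agreeM (fps2_agreeD pf pg) ph)) mulrDl !coefD.
rewrite (fps2_agree_coef (fps2_agreeM pf ph)).
by rewrite (fps2_agree_coef (fps2_agreeM pg ph)).
Qed.

Fact fps2_1neq0 : fps2C 1 != 0.
Proof.
apply/eqP => /(congr1 (fun f => coef2 f 0 0)) /= /eqP.
by rewrite oner_eq0.
Qed.

HB.instance Definition _ := GRing.Zmodule_isComNzRing.Build (fps2 R)
  fps2_mulA fps2_mulC fps2_mul1 fps2_mulDl fps2_1neq0.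

Lemma coef2_1 k m : (1 : fps2 R) k m = ((k == 0)%N && (m == 0)%N)%:R.
Proof. by rewrite /= ; case: ifP. Qed.

Lemma coef2M f g k m : (f * g) k m =
  \sum_(i < k.+1) \sum_(j < m.+1) f i j * g (k - i)%N (m - j)%N.
Proof. by []. Qed.

Lemma coef2M00 f g : (f * g) 0 0 = f 0 0 * g 0 0.
Proof. by rewrite coef2M !big_ord1. Qed.

Fact fps2C_is_zmod_morphism : zmod_morphism fps2C.
Proof.
move=> c d; apply: fps2P => k m; rewrite coef2B /=.
by case: ifP; rewrite ?subrr.
Qed.

Fact fps2C_is_monoid_morphism : monoid_morphism fps2C.
Proof.
split=> // c d; apply: fps2P => k m.
have := fps2_agreeM (@fps2_agreeC k m c) (@fps2_agreeC k m d).
move=> /fps2_agree_coef; rewrite -!polyCM => ->.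
exact/fps2_agree_coef/fps2_agreeC.
Qed.

HB.instance Definition _ :=
  GRing.isZmodMorphism.Build R (fps2 R) fps2C fps2C_is_zmod_morphism.
HB.instance Definition _ :=
  GRing.isMonoidMorphism.Build R (fps2 R) fps2C fps2C_is_monoid_morphism.

Lemma fps2_exp_low h n k m : h 0 0 = 0 -> (k + m < n)%N -> (h ^+ n) k m = 0.
Proof.
move=> h0; elim: n k m => [|n IHn] k m; first by [].
rewrite ltnS => le_km; rewrite exprS coef2M big1 // => i _.
rewrite big1 // => j _.
have le_ik : (i <= k)%N by rewrite -ltnS ltn_ord.
have le_jm : (j <= m)%N by rewrite -ltnS ltn_ord.
have [/eqP ij0 | ij_gt0] := posnP (i + j)%N.
  by move: ij0; rewrite addn_eq0 => /andP[/eqP-> /eqP->]; rewrite h0 mul0r.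
rewrite IHn ?mulr0 // (leq_trans _ le_km) //.
have <- : (k - i + (m - j) + (i + j) = k + m)%N by rewrite addnACA !subnK.
by rewrite -[ltnLHS]addn0 ltn_add2l.
Qed.

Definition fps2X : fps2 R := Fps2 (fun k m => ((k == 1)%N && (m == 0)%N)%:R).
Definition fps2Y : fps2 R := Fps2 (fun k m => ((k == 0)%N && (m == 1)%N)%:R).

End Ring.

(* A series is invertible iff its constant term u is, and the inverse is then *)
(* u^-1 * \sum_n (1 - u^-1 f)^n, only the terms n <= k + m of which           *)
(* contribute to the coefficient of x^k y^m.                                  *)
Section UnitRing.
Variable R : comUnitRingType.
Implicit Types f g : fps2 R.

Definition fps2_unit : pred (fps2 R) := fun f => f 0%N 0%N \is a GRing.unit.

Definition fps2_inv f : fps2 R :=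
  if fps2_unit f then
    let u := (f 0%N 0%N)^-1 in
    Fps2 (fun k m =>
      u * (\sum_(n < (k + m).+1) (1 - fps2C u * f) ^+ n : fps2 R) k m)
  else f.

Lemma coef2CM c f k m : (fps2C c * f) k m = c * f k m.
Proof.
rewrite coef2M big_ord_recl big_ord_recl /= !subn0 big1 ?addr0 => [|j _].
  by rewrite big1 ?addr0 // => i _; rewrite big1 // => j _; rewrite mul0r.
by rewrite mul0r.
Qed.

Fact fps2_mulVf : {in fps2_unit, left_inverse 1 fps2_inv *%R}.
Proof.
move=> f Uf0; have Uf : fps2_unit f := Uf0; apply: fps2P => k m.
rewrite /fps2_inv Uf; set u := (f 0%N 0%N)^-1; set h := 1 - fps2C u * f.
have h0 : h 0%N 0%N = 0 by rewrite /h coef2B coef2CM /u mulVr //= subrr.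
pose S : fps2 R := \sum_(n < (k + m).+1) h ^+ n.
have gS i j : (i <= k)%N -> (j <= m)%N ->
    u * (\sum_(n < (i + j).+1) h ^+ n : fps2 R) i j = (fps2C u * S) i j.
  move=> le_ik le_jm; rewrite coef2CM /S !coef2_sum; congr (_ * _).
  have le_n : ((i + j).+1 <= (k + m).+1)%N by rewrite ltnS leq_add.
  rewrite (big_ord_widen _ (fun n => (h ^+ n) i j) le_n).
  rewrite [LHS]big_mkcond; apply: eq_bigr => n _ /=; case: ltnP => //= lt_n.
  by rewrite fps2_exp_low.
transitivity ((fps2C u * S * f) k m).
  rewrite [LHS]coef2M [RHS]coef2M.
  apply: eq_bigr => i _; apply: eq_bigr => j _.
  by congr (_ * _); apply: gS; rewrite -ltnS ltn_ord.
have -> : fps2C u * S * f = 1 - h ^+ (k + m).+1.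
  rewrite -[RHS]opprB subrX1 -/S -mulNr opprB /h opprB addrC subrK.
  by rewrite mulrAC.
by rewrite coef2B fps2_exp_low // subr0.
Qed.

Fact fps2_unitPl f g : g * f = 1 -> fps2_unit f.
Proof.
move=> /(congr1 (fun s => coef2 s 0 0)); rewrite coef2M00 => gf1.
by apply/unitrPr; exists (g 0%N 0%N); rewrite mulrC.
Qed.

Fact fps2_inv_out : {in [predC fps2_unit], fps2_inv =1 id}.
Proof. by move=> f nUf; rewrite /fps2_inv ifN. Qed.

HB.instance Definition _ := GRing.ComNzRing_hasMulInverse.Build (fps2 R)
  fps2_mulVf fps2_unitPl fps2_inv_out.

Lemma fps2_unitE f : (f \is a GRing.unit) = (f 0%N 0%N \is a GRing.unit).
Proof. by []. Qed.

End UnitRing.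

(* For ks = (k_1, ..., k_n), the path N^{k_1} E^{a_1} ... N^{k_n} E^{a_n} is  *)
(* represented by the sequence a = (a_1, ..., a_n).                           *)

Local Open Scope nat_scope.

Definition is_dyck (ks a : seq nat) : bool :=
  [&& size a == size ks, sumn a == sumn ks
    & all (fun i => sumn (take i a) <= sumn (take i ks)) (iota 0 (size ks).+1)].

(* The subtraction is exact on Dyck paths, and j ranges over 0, ..., n - 1.   *)
Definition red_rank (ks a : seq nat) (j : nat) : nat :=
  sumn (take j ks) - sumn (take j a).

Definition area (ks a : seq nat) : nat :=
  sumn [seq red_rank ks a j | j <- iota 0 (size ks)].

(* The number of north steps preceding the east step that starts at abscissa  *)
(* x, i.e. the least j such that x < a_1 + ... + a_j.                         *)
Definition north_before (a : seq nat) (x : nat) : nat :=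
  find (fun j => x < sumn (take j a)) (iota 0 (size a).+1).

(* One run of the Xin-Zhang loop from stage i. The state consists of the      *)
(* abscissa x of P_i and the list cols of the filled columns of the diagram;  *)
(* the ordinate of P_i is k_1 + ... + k_s where s = size cols, because the    *)
(* number of filled columns is v_0 + ... + v_{i-1}.                           *)
Fixpoint bounce_loop (fuel : nat) (ks a : seq nat) (i x : nat)
    (cols : seq (seq nat)) : nat :=
  if fuel isn't fuel'.+1 then 0 else
  let s := size cols in
  if (x, sumn (take s ks)) == (sumn ks, sumn ks) then 0 else
  let v := north_before a x - s in
  let cols' := cols ++ [seq iota i k.+1 | k <- take v (drop s ks)] in
  let h := sumn [seq count_mem i.+1 c | c <- cols'] in
  i * v + bounce_loop fuel' ks a i.+1 (x + h) cols'.

(* For positive k_j every h_i is positive (as long as the end point is not    *)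
(* reached, some filled column contains i + 1), so that at most K iterations  *)
(* take place.                                                                *)
Definition bounce (ks a : seq nat) : nat := bounce_loop (sumn ks) ks a 0 0 [::].

Local Open Scope ring_scope.

Definition qt_ring : comUnitRingType := {poly {poly int}}.

Definition qvar : qt_ring := ('X : {poly int})%:P.
Definition tvar : qt_ring := 'X.

(* Each a_i is at most K, hence the finite index type.                        *)
Definition qt_catalan (ks : seq nat) : qt_ring :=
  \sum_(a : (size ks).-tuple 'I_(sumn ks).+1 | is_dyck ks (map val a))
    qvar ^+ area ks (map val a) * tvar ^+ bounce ks (map val a).

(* C_(k,k+m,k+m,k+m), with the convention for k = 0.                          *)
Definition qt_catalan4 (k m : nat) : qt_ring :=
  match k, m with
  | 0, 0 => 1
  | 0, _ => qt_catalan [:: m; m; m]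
  | _, _ => qt_catalan [:: k; k + m; k + m; k + m]%N
  end.

Definition H : fps2 qt_ring := Fps2 qt_catalan4.

Definition M (x y q t : fps2 qt_ring) : fps2 qt_ring :=
  (q^+13*t^+7 + q^+7*t^+13 + q^+12*t^+8 + q^+8*t^+12 + q^+9*t^+12
   + q^+12*t^+9 + q^+11*t^+11 + q^+10*t^+11 + q^+11*t^+10 + q^+9*t^+11
   + q^+11*t^+9 + q^+10*t^+10) * x^+3 * y^+2
  - (q^+11*t^+5 + q^+5*t^+11 + q^+10*t^+6 + q^+6*t^+10 + q^+8*t^+9
     + q^+9*t^+8 + q^+7*t^+9 + q^+9*t^+7 + q^+8*t^+8 - q^+7*t^+8
     - q^+8*t^+7 + q^+7*t^+7) * x^+2 * y^+2
  - (q^+7*t^+4 + q^+4*t^+7 + q^+6*t^+5 + q^+5*t^+6) * x * y^+2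
  - (q^+12*t^+6 + q^+6*t^+12 + q^+8*t^+11 + q^+11*t^+8 + q^+10*t^+8
     + q^+8*t^+10 + q^+7*t^+11 + q^+11*t^+7 + q^+7*t^+10 + q^+10*t^+7
     + 2 * q^+9*t^+9 + q^+8*t^+9 + q^+9*t^+8) * x^+3 * y
  - (q^+10*t^+3 + q^+3*t^+10 + q^+5*t^+7 + q^+7*t^+5 - q^+5*t^+9
     - q^+9*t^+5 + q^+4*t^+9 + q^+9*t^+4 + q^+4*t^+8 + q^+8*t^+4
     + q^+5*t^+6 + q^+6*t^+5 - q^+8*t^+6 - q^+6*t^+8) * x^+2 * y
  + (q*t^+8 + q^+8*t + q*t^+7 + q^+7*t + q^+6*t^+3 + q^+3*t^+6
     + q^+4*t^+5 + q^+5*t^+4 + q^+2*t^+5 + q^+5*t^+2 + 2 * q^+4*t^+4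
     + q^+5*t^+3 + q^+3*t^+5 + 2 * q^+3*t^+4 + 2 * q^+4*t^+3
     + q^+7*t^+2 + q^+2*t^+7 + q^+6*t^+2 + q^+2*t^+6) * x * y
  - (q^+2*t + q*t^+2) * y
  + (q^+9*t^+6 + q^+6*t^+9 + q^+8*t^+7 + q^+7*t^+8 + q^+8*t^+8) * x^+3
  + (q^+7*t^+3 + q^+3*t^+7 - q^+5*t^+6 - q^+6*t^+5 + q^+4*t^+6
     + q^+6*t^+4 + q^+5*t^+5 + q^+4*t^+5 + q^+5*t^+4) * x^+2
  - (q*t^+5 + q^+5*t + q^+2*t^+4 + q^+4*t^+2 + q*t^+4 + q^+4*t
     + q^+3*t^+3 + q^+2*t^+3 + q^+3*t^+2) * x
  - 1.

(* Main.v *)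
(** Column [j] of the diagram is filled at the first stage [i] at which the
    abscissa of [P_i] reaches that of the start of the [j]-th north step, and
    the bounce is the sum of these stages.  For [(k, l, l, l)] with
    [l = k + m], write the stages of the last three columns as [u], [u + c] and
    [u + c + d], and put [v = k - u]; then [0 <= c, d <= l], and the area is
    piecewise linear in [v, l, c, d].  Hence [C_(k,l,l,l)] is the sum over
    [u + v = k] of [t^(3u) T(v, l)], which means that the generating function
    [G] of [T(v, v + j)] satisfies
    [(y - x t^3) H(x, y) = y G(x, y) - x t^3 H(x, 0)], and this equation
    determines [H].  On each domain of linearity [T(v, v + j)] is a product of
    geometric convolutions, one in [v] and one in [j], so that [G] is a sum of
    products of geometric series, and the theorem reduces to a polynomial
    identity. *)

From mathcomp Require Import all_boot all_order all_algebra.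
From mathcomp Require Import zify ring.
Require Import Defs.

Set Implicit Arguments.
Unset Strict Implicit.
Unset Printing Implicit Defensive.

Import GRing.Theory.
Local Open Scope ring_scope.

(** * Geometric series and comparison of coefficients in R[[x, y]] *)

Section GeometricSeries.
Variable R : comUnitRingType.
Implicit Types (f g : fps2 R) (a b c : R).
Local Notation x := (fps2X R).
Local Notation y := (fps2Y R).

Lemma coef2XM f k m : (x * f) k m = if k is k'.+1 then f k' m else 0.
Proof.
rewrite coef2M; case: k => [|k].
  by rewrite big1 // => i _; rewrite big1 // => j _; rewrite ord1 mul0r.
rewrite big_ord_recl big1 ?add0r => [|j _]; last by rewrite mul0r.
rewrite big_ord_recl [X in _ + X]big1 ?addr0 => [|i _]; last first.
  by rewrite big1 // => j _; rewrite mul0r.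
rewrite big_ord_recl [X in _ + X]big1 ?addr0 => [|j _]; last by rewrite mul0r.
by rewrite /= mul1r !subSS !subn0.
Qed.

Lemma coef2YM f k m : (y * f) k m = if m is m'.+1 then f k m' else 0.
Proof.
rewrite coef2M big_ord_recl [X in _ + X]big1 ?addr0 => [|i _]; last first.
  by rewrite big1 // => j _; rewrite mul0r.
case: m => [|m]; first by rewrite big1 // => j _; rewrite ord1 mul0r.
rewrite big_ord_recl mul0r add0r big_ord_recl.
rewrite [X in _ + X]big1 ?addr0 => [|j _]; last by rewrite mul0r.
by rewrite /= mul1r !subSS !subn0.
Qed.

Lemma unit_subX f : 1 - x * f \is a GRing.unit.
Proof. by rewrite fps2_unitE coef2B coef2XM coef2_1 subr0 unitr1. Qed.

Lemma unit_subY f : 1 - y * f \is a GRing.unit.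
Proof. by rewrite fps2_unitE coef2B coef2YM coef2_1 subr0 unitr1. Qed.

(** The quotient g satisfies f = g - a x g, so that g_k = f_k + a g_(k-1); unrolling this recursion
    gives the convolution of f with the powers of a. *)
Lemma coef2_geoX f a k m :
  (f / (1 - x * fps2C a)) k m = \sum_(i < k.+1) a ^+ i * f (k - i)%N m.
Proof.
set g := f / _.
have fE : f = g - fps2C a * (x * g).
  by rewrite -[LHS](divrK (unit_subX (fps2C a))) -/g; ring.
clearbody g; have gE i : g i m = f i m + if i is i'.+1 then a * g i' m else 0.
  rewrite [in RHS]fE coef2B coef2CM coef2XM; case: i => [|i]; first by ring.
  by rewrite subrK.
elim: k => [|k IHk]; rewrite gE; first by rewrite big_ord1 mul1r addr0.
rewrite big_ord_recl subn0 mul1r IHk mulr_sumr; congr (_ + _).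
by apply: eq_bigr => i _; rewrite mulrA -exprS.
Qed.

Lemma coef2_geoY f a k m :
  (f / (1 - y * fps2C a)) k m = \sum_(i < m.+1) a ^+ i * f k (m - i)%N.
Proof.
set g := f / _.
have fE : f = g - fps2C a * (y * g).
  by rewrite -[LHS](divrK (unit_subY (fps2C a))) -/g; ring.
clearbody g; have gE i : g k i = f k i + if i is i'.+1 then a * g k i' else 0.
  rewrite [in RHS]fE coef2B coef2CM coef2YM; case: i => [|i]; first by ring.
  by rewrite subrK.
elim: m => [|m IHm]; rewrite gE; first by rewrite big_ord1 mul1r addr0.
rewrite big_ord_recl subn0 mul1r IHm mulr_sumr; congr (_ + _).
by apply: eq_bigr => i _; rewrite mulrA -exprS.
Qed.

Lemma coef2_XgeoX f a k m :
  (x * (f / (1 - x * fps2C a))) k m = \sum_(i < k) a ^+ i * f (k - i.+1)%N m.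
Proof.
rewrite coef2XM; case: k => [|k]; first by rewrite big_ord0.
by rewrite coef2_geoX; apply: eq_bigr => i _; rewrite subSS.
Qed.

Lemma coef2_YgeoY f a k m :
  (y * (f / (1 - y * fps2C a))) k m = \sum_(i < m) a ^+ i * f k (m - i.+1)%N.
Proof.
rewrite coef2YM; case: m => [|m]; first by rewrite big_ord0.
by rewrite coef2_geoY; apply: eq_bigr => i _; rewrite subSS.
Qed.

(** In this order the summation index is the argument of f, as needed when f itself carries a sum
    whose length is governed by the outer index. *)
Lemma coef2_XgeoX_rev f a k m :
  (x * (f / (1 - x * fps2C a))) k m = \sum_(i < k) a ^+ (k - i.+1) * f i m.
Proof.
rewrite coef2_XgeoX (reindex_inj rev_ord_inj); apply: eq_bigr => i _ /=.
by rewrite subnSK // subKn // ltnW.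
Qed.

Lemma coef2_YgeoY_rev f a k m :
  (y * (f / (1 - y * fps2C a))) k m = \sum_(i < m) a ^+ (m - i.+1) * f k i.
Proof.
rewrite coef2_YgeoY (reindex_inj rev_ord_inj); apply: eq_bigr => i _ /=.
by rewrite subnSK // subKn // ltnW.
Qed.

Lemma coef2_geoXY a b k m :
  ((1 - x * fps2C a)^-1 / (1 - y * fps2C b)) k m = a ^+ k * b ^+ m.
Proof.
have geo0 c n (F : nat -> R) : (forall i, F i.+1 = 0) ->
    \sum_(i < n.+1) c ^+ i * F (n - i)%N = c ^+ n * F 0%N.
  move=> F0; rewrite big_ord_recr subnn /= big1 ?add0r // => i _.
  by rewrite -subnSK // F0 mulr0.
rewrite coef2_geoY geo0 => [|i]; last first.
  rewrite -[_^-1]mul1r coef2_geoX big1 // => j _.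
  by rewrite coef2_1 andbF mulr0.
rewrite -[_^-1]mul1r coef2_geoX (geo0 _ _ (fun i => (1 : fps2 R) i 0%N)) //.
by rewrite coef2_1 mulr1 mulrC.
Qed.

Definition no_y f : Prop := forall k m, f k m.+1 = 0.

Lemma no_y_X : no_y x. Proof. by move=> k m; rewrite /= andbF. Qed.

Lemma no_y_C c : no_y (fps2C c). Proof. by move=> k m; rewrite /= andbF. Qed.

Lemma no_yD f g : no_y f -> no_y g -> no_y (f + g).
Proof. by move=> fy gy k m; rewrite coef2D fy gy addr0. Qed.

Lemma no_yN f : no_y f -> no_y (- f).
Proof. by move=> fy k m; rewrite coef2N fy oppr0. Qed.

Lemma no_yM f g : no_y f -> no_y g -> no_y (f * g).
Proof.
move=> fy gy k m; rewrite coef2M big1 // => i _.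
rewrite big1 // => -[[|j] lt_j] _.
  by rewrite subn0 gy mulr0.
by rewrite fy mul0r.
Qed.

Lemma no_yX f n : no_y f -> no_y (f ^+ n).
Proof.
move=> fy; elim: n => [|n IHn]; first by move=> k m; rewrite coef2_1 andbF.
by rewrite exprS; apply: no_yM.
Qed.

Lemma no_y_geoX f a : no_y f -> no_y (f / (1 - x * fps2C a)).
Proof.
by move=> fy k m; rewrite coef2_geoX big1 // => i _; rewrite fy mulr0.
Qed.

(** At x^k y^(m+1) the term x h vanishes, and the equation reads g_(k,m) = a g_(k-1,m+1) + f_(k,m).
    Induction on k, for all m at once, then determines g. In the application h is t^3 H(x, 0). *)
Lemma fps2_eq_rec f g h (F : nat -> nat -> R) a :
    no_y h -> (y - fps2C a * x) * g = y * f - x * h ->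
    (forall m, F 0%N m = f 0%N m) ->
    (forall k m, F k.+1 m = a * F k m.+1 + f k.+1 m) ->
  forall k m, g k m = F k m.
Proof.
move=> hy gE F0 FS.
have step k m : g k m = f k m + if k is k'.+1 then a * g k' m.+1 else 0.
  have /(congr1 (fun s => coef2 s k m.+1)) := gE.
  rewrite mulrBl !coef2B !coef2YM -mulrA coef2CM !coef2XM.
  case: k => [|k]; last by rewrite hy subr0 => <-; rewrite subrK.
  by rewrite mulr0 !subr0 => ->; rewrite addr0.
elim=> [|k IHk] m; rewrite step ?addr0 ?F0 // FS IHk addrC //.
Qed.

End GeometricSeries.

(** * Monomials in q and t, and the inner sums T(v, l) *)

Definition qt_mon (a b : nat) : qt_ring := qvar ^+ a * tvar ^+ b.

Lemma qt_monM a b c d : qt_mon a b * qt_mon c d = qt_mon (a + c) (b + d).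
Proof. by rewrite /qt_mon !exprD mulrACA. Qed.

Lemma qt_monX a b n : qt_mon a b ^+ n = qt_mon (n * a) (n * b).
Proof. by rewrite /qt_mon exprMn -!exprM mulnC [(b * n)%N]mulnC. Qed.

Lemma qt_mon_congr a b c d : a = c -> b = d -> qt_mon a b = qt_mon c d.
Proof. by move=> -> ->. Qed.

(** The q-integer [3]: three consecutive abscissas passed at one stage have areas differing by 2, 1,
    0. Likewise 1 + q stands for two abscissas. *)
Definition qt3 : qt_ring := 1 + qvar + qvar ^+ 2.

(* Sum over the start of the last north step, which is reached at stage
   [u + c + d]. Here [a = (v - c)^+] and [b = l - c] are the numbers of stages
   after [u + c] during which the first two columns still contribute a cell, so
   that 3, 2 or 1 abscissas are passed per stage. [w0] is the weight of the term
   [d = 0]. *)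
Definition third_sum (w0 w : qt_ring) (a b l : nat) : qt_ring :=
  w0 * qt_mon (a + b + l) 0
  + w * qt3 * (\sum_(d < a)
      qt_mon ((a - d.+1) + (b - d.+1) + (l - d.+1)) d.+1)
  + w * (1 + qvar) * (\sum_(i < b - a)
      qt_mon ((b - (a + i).+1) + (l - (a + i).+1)) (a + i).+1)
  + w * (\sum_(r < l - b) qt_mon (l - (b + r).+1) (b + r).+1).

(* T(v, l); the three summands are c = 0, 0 < c <= v and v < c <= l. *)
Definition second_sum (v l : nat) : qt_ring :=
  qt_mon (v + v + l) 0 * third_sum 1 1 v l l
  + (\sum_(c < v) qt_mon (v + (v - c.+1) + (l - c.+1)) (2 * c.+1)
      * third_sum qt3 (1 + qvar) (v - c.+1) (l - c.+1) l)
  + \sum_(e < l - v) qt_mon (v + (l - (v + e).+1)) (2 * (v + e).+1)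
      * third_sum 1 1 0 (l - (v + e).+1) l.

(** * Generating function of T(v, v + j) in x^v y^j *)

Section SecondSumSeries.
Local Notation x := (fps2X qt_ring).
Local Notation y := (fps2Y qt_ring).
Local Notation "''X_' ( a , b )" := (1 - x * fps2C (qt_mon a b)) (at level 8).
Local Notation "''Y_' ( a , b )" := (1 - y * fps2C (qt_mon a b)) (at level 8).

(** The summand c = 0. The term d = 0 is q^(6v+3j); the terms 0 < d <= v form a convolution in v of
    the ratios q^6 and q^3 t, and the terms v < d <= l one in j of q^3 and q t. *)
Definition gf_low : fps2 qt_ring :=
  'X_(6, 0)^-1 / 'Y_(3, 0)
  + fps2C (qt3 * qt_mon 3 1) * (x * ('X_(6, 0)^-1 / 'Y_(3, 0) / 'X_(3, 1)))
  + fps2C ((1 + qvar) * qt_mon 1 1)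
    * (y * ('X_(3, 1)^-1 / 'Y_(3, 0) / 'Y_(1, 1))).

(** The range 0 < c <= v. Division by ['X_(2, 2)] sums over c a bracket shaped like [gf_low], which
    covers d <= l - c. In the last summand, for l - c < d <= l, division by ['X_(1, 3)] sums over d
    and division by ['X_(3, 1)] over c. *)
Definition gf_mid : fps2 qt_ring :=
  fps2C (qt_mon 2 2) * (x * ((
    fps2C qt3 * ('X_(6, 0)^-1 / 'Y_(3, 0))
    + fps2C ((1 + qvar) * qt3 * qt_mon 3 1)
      * (x * ('X_(6, 0)^-1 / 'Y_(3, 0) / 'X_(3, 1)))
    + fps2C ((1 + qvar) ^+ 2 * qt_mon 1 1)
      * (y * ('X_(3, 1)^-1 / 'Y_(3, 0) / 'Y_(1, 1)))) / 'X_(2, 2)))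
  + fps2C ((1 + qvar) * qt_mon 1 3)
    * (x * ('X_(2, 2)^-1 / 'Y_(1, 1) / 'X_(1, 3) / 'X_(3, 1))).

(** The range c = v + e + 1 with e < j. The first summand covers d <= l - c. The range l - c < d <=
    l has length e + v + 1, which depends on both variables; it is cut into two convolutions, the
    last two summands. *)
Definition gf_high : fps2 qt_ring :=
  fps2C (qt_mon 1 2) * (y * (('X_(2, 2)^-1 / 'Y_(3, 0)
    + fps2C ((1 + qvar) * qt_mon 1 1)
      * (y * ('X_(2, 2)^-1 / 'Y_(3, 0) / 'Y_(1, 1)))) / 'Y_(1, 2)))
  + fps2C (qt_mon 0 3) * (y * ('X_(2, 2)^-1 / 'Y_(1, 1) / 'X_(1, 3) / 'Y_(0, 3)))
  + fps2C (qt_mon 1 5)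
    * (y * (y * ('X_(2, 2)^-1 / 'Y_(1, 2) / 'Y_(0, 3)) / 'Y_(1, 1))).

Ltac mon_eq := rewrite /= ?mul1r ?mulr1 ?qt_monX ?qt_monM;
  apply: qt_mon_congr; lia.

Lemma coef_gf_low v j : gf_low v j =
  qt_mon (v + v + (v + j)) 0 * third_sum 1 1 v (v + j) (v + j).
Proof.
rewrite /gf_low !coef2D !coef2CM coef2_XgeoX coef2_YgeoY coef2_geoXY.
rewrite /third_sum subnn big_ord0 mulr0 addr0 !mul1r !mulrDr.
rewrite [(v + j - v)%N](addKn v j).
congr (_ + _ + _).
- by mon_eq.
- rewrite -[in LHS](mulrA qt3) !(mulrCA _ qt3); congr (_ * _).
  rewrite !mulr_sumr; apply: eq_bigr => i _.
  rewrite coef2_geoXY; have := ltn_ord i.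
  by move=> ?; mon_eq.
- rewrite -[in LHS](mulrA (1 + qvar)) !(mulrCA _ (1 + qvar)); congr (_ * _).
  rewrite !mulr_sumr; apply: eq_bigr => i _.
  rewrite coef2_geoXY; have := ltn_ord i.
  by move=> ?; mon_eq.
Qed.

Lemma coef_gf_mid v j : gf_mid v j =
  \sum_(c < v) qt_mon (v + (v - c.+1) + (v + j - c.+1)) (2 * c.+1)
      * third_sum qt3 (1 + qvar) (v - c.+1) (v + j - c.+1) (v + j).
Proof.
rewrite /gf_mid /third_sum; move: qt3 (1 + qvar) => s w.
rewrite coef2D !coef2CM coef2_XgeoX coef2_XgeoX_rev.
rewrite !mulr_sumr -big_split; apply: eq_bigr => c _.
have c_lt := ltn_ord c.
rewrite !coef2D !coef2CM coef2_XgeoX coef2_YgeoY coef2_geoXY coef2_geoX.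
rewrite !mulrDr.
have -> : (v + j - c.+1 - (v - c.+1) = j)%N by lia.
have -> : (v + j - (v + j - c.+1) = c.+1)%N by lia.
congr (_ + _ + _ + _).
- by rewrite !(mulrCA _ s); congr (_ * _); mon_eq.
- rewrite -[in LHS](mulrA (w * s)) !(mulrCA _ (w * s)); congr (_ * _).
  rewrite !mulr_sumr; apply: eq_bigr => i _; rewrite coef2_geoXY.
  by have i_lt := ltn_ord i; mon_eq.
- rewrite -expr2 -[in LHS](mulrA (w ^+ 2)) !(mulrCA _ (w ^+ 2)); congr (_ * _).
  rewrite !mulr_sumr; apply: eq_bigr => i _; rewrite coef2_geoXY.
  by have i_lt := ltn_ord i; mon_eq.
- rewrite -[in LHS](mulrA w) !(mulrCA _ w); congr (_ * _).
  rewrite !mulr_sumr; apply: eq_bigr => i _; rewrite coef2_geoXY.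
  by have i_lt := ltn_ord i; mon_eq.
Qed.

Lemma coef_gf_high v j : gf_high v j =
  \sum_(e < j) qt_mon (v + (v + j - (v + e).+1)) (2 * (v + e).+1)
      * third_sum 1 1 0 (v + j - (v + e).+1) (v + j).
Proof.
rewrite /gf_high !coef2D !coef2CM 2!coef2_YgeoY coef2_YgeoY_rev.
rewrite !mulr_sumr -!big_split; apply: eq_bigr => e _.
have e_lt := ltn_ord e.
rewrite !coef2D !coef2CM coef2_geoXY coef2_geoX !coef2_YgeoY.
rewrite /third_sum big_ord0 mulr0 addr0 !mul1r -[LHS]/(_ + _ + _) !mulrDr -!addrA.
have -> : (v + j - (v + j - (v + e).+1) = e + v.+1)%N by lia.
congr (_ + (_ + _)).
- by mon_eq.
- rewrite -[in LHS](mulrA (1 + qvar)) !(mulrCA _ (1 + qvar)); congr (_ * _).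
  have -> : (v + j - (v + e).+1 - 0 = j - e.+1)%N by lia.
  rewrite !mulr_sumr; apply: eq_bigr => i _; rewrite coef2_geoXY.
  by have i_lt := ltn_ord i; mon_eq.
(* The first e values of r give the iterated convolution in y, the remaining v + 1 the convolution
   in x with ratio q t^3. *)
- rewrite big_split_ord addrC !mulrDr; congr (_ + _).
    rewrite !mulr_sumr; apply: eq_bigr => i _; rewrite coef2_geoXY.
    by have i_lt := ltn_ord i; rewrite /=; mon_eq.
  rewrite !mulr_sumr; apply: eq_bigr => i _; rewrite coef2_geoXY.
  by have i_lt := ltn_ord i; rewrite /=; mon_eq.
Qed.

Lemma coef_gf v j : (gf_low + gf_mid + gf_high) v j = second_sum v (v + j).
Proof.
by rewrite 2!coef2D coef_gf_low coef_gf_mid coef_gf_high /second_sum addKn.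
Qed.

End SecondSumSeries.

(** * The bounce as the sum of the filling stages of the columns *)

Section Bounce.
Local Open Scope nat_scope.
Implicit Types (ks a bs : seq nat) (i j s : nat).

Lemma sumn_take_big a s : s <= size a ->
  sumn (take s a) = \sum_(0 <= j < s) nth 0 a j.
Proof.
elim: s => [|s IHs] le_s; first by rewrite take0 big_geq.
by rewrite (take_nth 0) // sumn_rcons IHs 1?ltnW // big_nat_recr.
Qed.

Lemma sumn_take_leq a i j : i <= j -> sumn (take i a) <= sumn (take j a).
Proof.
move=> le_ij; rewrite -(cat_take_drop i (take j a)) take_takel //.
by rewrite sumn_cat leq_addr.
Qed.

Lemma count_mem_iota b n i : count_mem i (iota b n) = (b <= i < b + n) :> nat.
Proof. by rewrite count_uniq_mem ?iota_uniq // mem_iota. Qed.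

(** Partial sums are nondecreasing, so the least index whose partial sum exceeds x separates the
    north steps that start at an abscissa at most x from the others. *)
Lemma north_before_lt a x j : x < sumn a -> j < size a ->
  (j < north_before a x) = (sumn (take j a) <= x).
Proof.
move=> lt_x lt_j; rewrite /north_before; set p := fun _ => _.
set s := iota _ _.
have p_n : has p s.
  apply/hasP; exists (size a); first by rewrite mem_iota add0n leqnn.
  by rewrite /p take_size.
have := nth_find 0 p_n; have := p_n; rewrite has_find size_iota => lt_f.
rewrite nth_iota // add0n /p => p_f; apply/idP/idP => [lt_jf | le_jx].
  have := before_find 0 lt_jf; rewrite nth_iota ?add0n; last exact: ltnW.
  by rewrite /p ltnNge => /negbFE.
rewrite ltnNge; apply/negP => /(sumn_take_leq a) le_fj.
by have := leq_trans p_f le_fj; rewrite ltnNge le_jx.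
Qed.

Lemma north_before_le a x : x < sumn a -> north_before a x <= size a.
Proof.
move=> lt_x; have : has (fun j => x < sumn (take j a)) (iota 0 (size a).+1).
  apply/hasP; exists (size a); first by rewrite mem_iota add0n leqnn.
  by rewrite take_size.
by rewrite has_find size_iota.
Qed.

(* Abscissa of P_i when column j of the diagram is filled at stage b_j. *)
Definition bounce_abscissa ks bs i :=
  \sum_(0 <= j < size ks) minn (nth 0 ks j) (i - nth 0 bs j).

(** The list [cols] of the loop after s columns, column j having been filled at stage b_j. *)
Definition bounce_columns ks bs s :=
  [seq iota (nth 0 bs j) (nth 0 ks j).+1 | j <- iota 0 s].

Lemma bounce_columns_cat ks bs i s s' : s <= s' -> s' <= size ks ->
    (forall j, s <= j < s' -> nth 0 bs j = i) ->
  bounce_columns ks bs s ++ [seq iota i k.+1 | k <- take (s' - s) (drop s ks)] =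
  bounce_columns ks bs s'.
Proof.
move=> le_ss' le_s'n bs_i; rewrite /bounce_columns -[in RHS](subnKC le_ss') iotaD.
rewrite map_cat; congr (_ ++ _); apply: (@eq_from_nth _ [::]).
  by rewrite !size_map size_takel ?size_iota // size_drop leq_sub2r.
move=> j; rewrite size_map size_takel ?size_drop ?leq_sub2r // => lt_j.
rewrite (nth_map 0) ?size_takel ?size_drop ?leq_sub2r // nth_take // nth_drop.
rewrite (nth_map 0) ?size_iota // nth_iota // add0n bs_i //; lia.
Qed.

Lemma sumn_count_columns ks bs i s :
  sumn [seq count_mem i.+1 c | c <- bounce_columns ks bs s] =
  \sum_(0 <= j < s) (nth 0 bs j <= i.+1 <= nth 0 bs j + nth 0 ks j).
Proof.
rewrite /bounce_columns -map_comp sumnE big_map /index_iota subn0.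
apply: eq_bigr => j _ /=; have := count_mem_iota (nth 0 bs j) (nth 0 ks j).+1 i.+1.
by rewrite /= addnS ltnS.
Qed.

(** A filled column contains i + 1 exactly when min(k_j, i - b_j) grows by one from i to i + 1. For
    an unfilled column b_j > i, and the minimum stays 0. *)
Lemma bounce_abscissaS ks bs i s : s <= size ks ->
    (forall j, j < size ks -> (j < s) = (nth 0 bs j <= i)) ->
  bounce_abscissa ks bs i.+1 = bounce_abscissa ks bs i +
    sumn [seq count_mem i.+1 c | c <- bounce_columns ks bs s].
Proof.
move=> le_sn sP; rewrite sumn_count_columns /bounce_abscissa.
rewrite (@big_cat_nat _ _ _ s 0 (size ks)) //=.
rewrite [in RHS](@big_cat_nat _ _ _ s 0 (size ks)) //=.
rewrite addnAC -big_split; congr (_ + _); apply: eq_big_nat => j /= j_s.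
  have := sP j (leq_trans j_s le_sn); rewrite j_s => /esym b_le.
  by case: (boolP (_ <= _ <= _)) => /=; lia.
by have := sP j (andP j_s).2; lia.
Qed.

Lemma bounce_abscissa_le ks bs i : bounce_abscissa ks bs i <= sumn ks.
Proof.
rewrite -[X in _ <= sumn X](take_size ks) sumn_take_big //.
by apply: leq_sum => j _; apply: geq_minl.
Qed.

(** The abscissa is K only if every column contributes all of k_j > 0, which forces i > b_j. *)
Lemma bounce_abscissa_full ks bs i : all (leq 1) ks ->
    bounce_abscissa ks bs i = sumn ks ->
  forall j, j < size ks -> nth 0 bs j < i.
Proof.
move=> /allP ks_gt0 X_i j lt_j; rewrite ltnNge; apply/negP => le_i.
have k_gt0 : 0 < nth 0 ks j by rewrite ks_gt0 ?mem_nth.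
have : bounce_abscissa ks bs i < sumn ks; last by rewrite X_i ltnn.
rewrite -[X in _ < sumn X](take_size ks) sumn_take_big // /bounce_abscissa.
rewrite !big_mkord (bigD1 (Ordinal lt_j)) // [ltnRHS](bigD1 (Ordinal lt_j)) //=.
rewrite (eqP le_i) minn0 -addSn leq_add //.
by apply: leq_sum => l _; apply: geq_minl.
Qed.

(** If no filled column contained i + 1, all of them would be exhausted and the abscissa would be at
    least k_1 + ... + k_s >= a_1 + ... + a_s. This strict progress is what makes K units of fuel
    sufficient. *)
Lemma bounce_abscissa_lt ks a bs i s : s <= size ks -> size a = size ks ->
    (forall j, j < size ks -> (j < s) = (nth 0 bs j <= i)) ->
    sumn (take s a) <= sumn (take s ks) ->
    bounce_abscissa ks bs i < sumn (take s a) ->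
  bounce_abscissa ks bs i < bounce_abscissa ks bs i.+1.
Proof.
move=> le_sn sz_a sP dyck_s lt_X; rewrite (bounce_abscissaS le_sn sP).
rewrite -[ltnLHS]addn0 ltn_add2l lt0n; apply/negP => /eqP.
rewrite sumn_count_columns => /eqP; rewrite sum_nat_seq_eq0 => /allP no_cell.
have := leq_trans lt_X dyck_s; rewrite sumn_take_big // ltnNge => /negP; apply.
rewrite /bounce_abscissa [leqRHS](@big_cat_nat _ _ _ s) //=.
apply: leq_trans (leq_addr _ _); rewrite big_seq [leqRHS]big_seq.
apply: leq_sum => j; rewrite mem_index_iota => /andP[_ lt_js].
have := no_cell j; rewrite mem_index_iota lt_js eqb0 => /(_ isT) /=.
by have := sP j (leq_trans lt_js le_sn); rewrite lt_js => /esym; lia.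
Qed.

(** Loop invariant: s columns have been filled before stage i, and the fuel covers the remaining
    distance to abscissa K. Stage i fills the columns s <= j < s', all with b_j = i, so the summand
    i v is their share of the sum. *)
Lemma bounce_loopE ks a bs fuel i s :
    all (leq 1) ks -> is_dyck ks a -> size bs = size ks ->
    (forall i j, j < size ks -> bounce_abscissa ks bs i < sumn ks ->
      (nth 0 bs j <= i) = (sumn (take j a) <= bounce_abscissa ks bs i)) ->
    s <= size ks -> (forall j, j < size ks -> (j < s) = (nth 0 bs j < i)) ->
    sumn ks <= fuel + bounce_abscissa ks bs i ->
  bounce_loop fuel ks a i (bounce_abscissa ks bs i) (bounce_columns ks bs s) =
  \sum_(s <= j < size ks) nth 0 bs j.
Proof.
move=> ks_gt0 /and3P[/eqP sz_a /eqP sum_a dyck_a] sz_bs bsP.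
have end_s i' s' : s' <= size ks ->
    (forall j, j < size ks -> (j < s') = (nth 0 bs j < i')) ->
    bounce_abscissa ks bs i' = sumn ks -> s' = size ks.
  move=> le_s s'P X_i'; apply/eqP; rewrite eqn_leq le_s leqNgt; apply/negP => lt_s.
  by have := s'P _ lt_s; rewrite ltnn (bounce_abscissa_full ks_gt0 X_i').
elim: fuel i s => [|fuel IHfuel] i s le_s sP le_fuel /=.
  rewrite (end_s i s) // ?big_geq //.
  by apply/eqP; rewrite eqn_leq bounce_abscissa_le.
have sz_cols : size (bounce_columns ks bs s) = s by rewrite size_map size_iota.
rewrite sz_cols xpair_eqE; case: eqP => [X_i | X_i] /=.
  by rewrite (end_s i s) // take_size eqxx big_geq.
have lt_X : bounce_abscissa ks bs i < sumn ks.
  by rewrite ltn_neqAle bounce_abscissa_le andbT; apply/eqP.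
set s' := north_before a _.
have s'P j : j < size ks -> (j < s') = (nth 0 bs j <= i).
  by move=> lt_j; rewrite bsP // north_before_lt ?sz_a // sum_a.
have le_s'n : s' <= size ks by rewrite -sz_a north_before_le // sum_a.
have le_ss' : s <= s'.
  rewrite leqNgt; apply/negP => lt_s's; have lt_s'n := leq_trans lt_s's le_s.
  by have := s'P _ lt_s'n; have := sP _ lt_s'n; rewrite ltnn lt_s's; lia.
have bs_i j : s <= j < s' -> nth 0 bs j = i.
  move=> /andP[le_sj lt_js']; have lt_jn := leq_trans lt_js' le_s'n.
  by have := s'P _ lt_jn; have := sP _ lt_jn; rewrite ltnNge le_sj lt_js'; lia.
rewrite (bounce_columns_cat le_ss' le_s'n bs_i) -bounce_abscissaS //.
(* Either column s' is still unfilled, so that its north step starts beyond P_i, or all columns are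
   filled and the sum is K. *)
have lt_XA : bounce_abscissa ks bs i < sumn (take s' a).
  have [lt_s' | ge_s'] := ltnP s' (size ks); last first.
    by rewrite take_oversize ?sum_a // sz_a.
  by rewrite ltnNge -bsP // -s'P // ltnn.
have lt_XS : bounce_abscissa ks bs i < bounce_abscissa ks bs i.+1.
  apply: (@bounce_abscissa_lt _ a _ _ s') => //.
  by move/allP: dyck_a => /(_ s'); rewrite mem_iota add0n; apply.
rewrite IHfuel //; last by lia.
rewrite [RHS](@big_cat_nat _ _ _ s') //=; congr (_ + _).
rewrite (eq_big_nat _ _ (F2 := fun=> i)) => [|j /bs_i //].
by rewrite sum_nat_const_nat mulnC.
Qed.

(** Reduces the computation of a bounce to guessing the stages b_j and checking that b_j is the
    first stage at which the abscissa reaches the start of north step j. *)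
Lemma bounceE ks a bs :
    all (leq 1) ks -> is_dyck ks a -> size bs = size ks ->
    (forall i j, j < size ks -> bounce_abscissa ks bs i < sumn ks ->
      (nth 0 bs j <= i) = (sumn (take j a) <= bounce_abscissa ks bs i)) ->
  bounce ks a = sumn bs.
Proof.
move=> ks_gt0 a_dyck sz_bs bsP; rewrite /bounce.
have X0 : bounce_abscissa ks bs 0 = 0.
  by rewrite /bounce_abscissa big1 // => j _; rewrite sub0n minn0.
rewrite -[X in bounce_loop _ _ _ _ X]X0 (@bounce_loopE _ _ bs _ _ 0) ?leq_addr //.
by rewrite -[RHS]/(sumn bs) -(take_size bs) sumn_take_big // take_size sz_bs.
Qed.

End Bounce.

(** * Reindexing of sums over tuples and intervals *)

Section Sums.
Variable V : nmodType.
Implicit Types (F : nat -> V).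

Lemma sum_tuple_cons N n (G : seq nat -> V) :
  \sum_(a : n.+1.-tuple 'I_N) G (map val a) =
  \sum_(0 <= i < N) \sum_(a : n.-tuple 'I_N) G (i :: map val a).
Proof.
rewrite big_mkord pair_big /=.
rewrite (reindex (fun p : 'I_N * n.-tuple 'I_N => cons_tuple p.1 p.2)) //=.
exists (fun a : n.+1.-tuple 'I_N => (thead a, behead_tuple a)) => [[i a] | a] _.
  by congr pair; apply: val_inj.
by rewrite [RHS]tuple_eta; apply: val_inj.
Qed.

Lemma sum_tuple_nil N (G : seq nat -> V) :
  \sum_(a : 0.-tuple 'I_N) G (map val a) = G [::].
Proof.
rewrite (big_pred1 [tuple]) // => a; apply/esym/eqP/val_inj.
by rewrite tuple0.
Qed.

(** Replaces the length i of a run of east steps by the abscissa A + i at which it ends. *)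
Lemma sum_nat_shift N A B F : (B < N)%N -> (A <= B)%N ->
  \sum_(0 <= i < N) (if (A + i <= B)%N then F (A + i)%N else 0) =
  \sum_(A <= i < B.+1) F i.
Proof.
move=> lt_BN le_AB; rewrite -[A in RHS]add0n big_addn.
rewrite (@big_cat_nat _ _ _ (B.+1 - A)) //=; last by lia.
rewrite [X in _ + X]big1_seq ?addr0 => [|i]; last first.
  by rewrite mem_index_iota /= => i_ge; rewrite ifN //; lia.
by apply: eq_big_nat => i i_lt; rewrite addnC ifT //; lia.
Qed.

Lemma sum_nat_pick N A B F : (B < N)%N -> (A <= B)%N ->
  \sum_(0 <= i < N) (if (A + i == B)%N then F i else 0) = F (B - A)%N.
Proof.
move=> lt_BN le_AB; rewrite big_mkord.
have lt_N : (B - A < N)%N by lia.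
rewrite (bigD1 (Ordinal lt_N)) //= subnKC // eqxx big1 ?addr0 // => i.
by rewrite -val_eqE /= => i_neq; rewrite ifN //; lia.
Qed.

(** Cuts an interval into n blocks of length s, the abscissas passed at n successive stages. *)
Lemma sum_nat_steps A n s F :
  \sum_(A.+1 <= i < (A + n * s).+1) F i =
  \sum_(d < n) \sum_(r < s) F (A + d * s + r.+1)%N.
Proof.
elim: n => [|n IHn]; first by rewrite big_geq ?big_ord0 ?addn0.
rewrite big_ord_recr /= -IHn (@big_cat_nat _ _ _ (A + n * s).+1) /=; [|lia|lia].
congr (_ + _); rewrite -[X in index_iota X]add0n big_addn.
have -> : ((A + n.+1 * s).+1 - (A + n * s).+1 = s)%N by lia.
by rewrite big_mkord; apply: eq_bigr => i _; congr F; lia.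
Qed.

End Sums.

(** * Summation over the starts of the last two north steps *)

Lemma qt2_mon a b : (1 + qvar) * qt_mon a b = qt_mon a.+1 b + qt_mon a b.
Proof. by rewrite /qt_mon exprS; ring. Qed.

Lemma qt3_mon a b :
  qt3 * qt_mon a b = qt_mon a.+2 b + qt_mon a.+1 b + qt_mon a b.
Proof. by rewrite /qt_mon /qt3 !exprS; ring. Qed.

(* [A2] and [A3] are the abscissas of the starts of the last two north steps.
   The hypothesis on [bnc] says that they lie in the intervals swept at stages
   [u + c] and [u + c + d]. *)
Section Tail.
Variables (u v l : nat) (bnc : nat -> nat -> nat).
Hypothesis le_vl : (v <= l)%N.
Hypothesis bncE : forall c d A2 A3, (c <= l)%N -> (d <= l)%N ->
  (u <= A2 <= A3)%N -> (A2 <= u + minn v c + c)%N ->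
  (0 < c -> u + minn v c.-1 + c.-1 < A2)%N ->
  (A3 <= u + minn v c + c + minn (v - c) d + minn (l - c) d + d)%N ->
  (0 < d -> u + minn v c + c + minn (v - c) d.-1 + minn (l - c) d.-1 + d.-1
     < A3)%N ->
  bnc A2 A3 = (3 * u + 2 * c + d)%N.

(** The exponent of q adds the red ranks of the last three north steps of (u + v, l, l, l), which
    start at abscissas u, [A2], [A3]. *)
Let tail_mon A2 A3 :=
  qt_mon (v + (u + v + l - A2) + (u + v + 2 * l - A3)) (bnc A2 A3).

Lemma tail_monE c d A2 A3 E T : (c <= l)%N -> (d <= l)%N ->
  (u <= A2 <= A3)%N -> (A2 <= u + minn v c + c)%N ->
  (0 < c -> u + minn v c.-1 + c.-1 < A2)%N ->
  (A3 <= u + minn v c + c + minn (v - c) d + minn (l - c) d + d)%N ->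
  (0 < d -> u + minn v c + c + minn (v - c) d.-1 + minn (l - c) d.-1 + d.-1
     < A3)%N ->
  E = (v + (u + v + l - A2) + (u + v + 2 * l - A3))%N ->
  T = (3 * u + 2 * c + d)%N -> tail_mon A2 A3 = qt_mon E T.
Proof.
move=> cl dl uA A2c cA2 A3d dA3 -> ->; apply: qt_mon_congr => //.
exact: (@bncE c d).
Qed.

(** Here [A2] lies e below X, the last abscissa swept at stage u + c; e = 1 requires c <= v, when
    two abscissas are swept. The choices of [A3] with d = 0 are those from [A2] to X, whence the
    weight 1 + q if e = 1. *)
Lemma sum_tail_mon c (e : bool) A2 : (c <= l)%N -> (e <= c)%N -> (e -> c <= v)%N ->
    (A2 + e = u + minn v c + c)%N ->
  \sum_(A2 <= A3 < (u + v + 2 * l).+1) tail_mon A2 A3 =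
  qt_mon (v + (v - c) + (l - c) + e) (3 * u + 2 * c)
    * third_sum (if e then 1 + qvar else 1) 1 (v - c) (l - c) l.
Proof.
move=> le_cl le_ec e_cv A2E; set X := (u + minn v c + c)%N in A2E *.
(* Beyond X, three columns are active while d <= v - c, then two while d <= l - c, then one while d
   <= l. *)
have XE : (u + v + 2 * l = X + (v - c) * 3 + (l - c - (v - c)) * 2
             + (l - (l - c)) * 1)%N by rewrite /X; lia.
rewrite (@big_cat_nat _ _ _ X.+1) /=; [|lia|lia].
rewrite (@big_cat_nat _ _ _ (X + (v - c) * 3).+1 X.+1) /=; [|lia|lia].
rewrite (@big_cat_nat _ _ _ (X + (v - c) * 3 + (l - c - (v - c)) * 2).+1
  (X + (v - c) * 3).+1) /=; [|lia|lia].
rewrite [in X in _ + (_ + (_ + X))]XE !sum_nat_steps.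
rewrite /third_sum !mul1r !mulrDr -!addrA; congr (_ + (_ + (_ + _))).
- have tE A3 : (A2 <= A3 <= X)%N ->
      tail_mon A2 A3 = qt_mon (v + (v - c) + (l - c) + e + (X - A3)
                          + ((v - c) + (l - c) + l)) (3 * u + 2 * c).
    by move=> A3_X; apply: (@tail_monE c 0); rewrite /X in A2E A3_X *; lia.
  case: e le_ec e_cv A2E tE => le_ec e_cv A2E tE.
    have -> : X = A2.+1 by lia.
    rewrite big_nat_recl // big_nat1 !tE /=; [|lia|lia].
    by rewrite mulrCA qt_monM qt2_mon; congr (_ + _); apply: qt_mon_congr; lia.
  have -> : X = A2 by lia.
  rewrite /= big_nat1 tE; last by lia.
  by rewrite mul1r qt_monM; apply: qt_mon_congr; lia.
- rewrite mulrCA !mulr_sumr; apply: eq_bigr => d _; have d_lt := ltn_ord d.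
  rewrite 3!big_ord_recr big_ord0 /= add0r qt_monM qt3_mon.
  by congr (_ + _ + _); apply: (@tail_monE c d.+1); rewrite /X in A2E *; lia.
- rewrite mulrCA !mulr_sumr; apply: eq_bigr => d _; have d_lt := ltn_ord d.
  rewrite 2!big_ord_recr big_ord0 /= add0r qt_monM qt2_mon.
  by congr (_ + _); apply: (@tail_monE c (v - c + d).+1); rewrite /X in A2E *; lia.
- rewrite !mulr_sumr; apply: eq_bigr => d _; have d_lt := ltn_ord d.
  rewrite big_ord1 qt_monM /=.
  by apply: (@tail_monE c (l - c + d).+1); rewrite /X in A2E *; lia.
Qed.

(** Adds the two positions of [A2] within one stage: the earlier one has area larger by one. The
    term d = 0 gets q (1 + q) + 1, the others q + 1. *)
Lemma third_sum_step a b l' :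
  qvar * third_sum (1 + qvar) 1 a b l' + third_sum 1 1 a b l' =
  third_sum qt3 (1 + qvar) a b l'.
Proof. by rewrite /third_sum /qt3; ring. Qed.

Lemma sum_tail :
  \sum_(u <= A2 < (u + v + l).+1) \sum_(A2 <= A3 < (u + v + 2 * l).+1)
    tail_mon A2 A3 = qt_mon 0 (3 * u) * second_sum v l.
Proof.
(* [A2] = u is the case c = 0; each stage with 0 < c <= v sweeps two abscissas, each with v < c <= l
   one. *)
have AE : (u + v + l = u + v * 2 + (l - v) * 1)%N by lia.
rewrite (@big_cat_nat _ _ _ u.+1) /=; [|lia|lia].
rewrite (@big_cat_nat _ _ _ (u + v * 2).+1 u.+1) /=; [|lia|lia].
rewrite [in X in _ + (_ + X)]AE !sum_nat_steps big_nat1.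
rewrite /second_sum 2!mulrDr -!addrA; congr (_ + (_ + _)).
- rewrite (@sum_tail_mon 0 false) ?addn0 ?subn0 ?minn0 //.
  by rewrite mulrA qt_monM; congr (_ * _); apply: qt_mon_congr; lia.
- rewrite mulr_sumr; apply: eq_bigr => c _; have c_lt := ltn_ord c.
  rewrite 2!big_ord_recr big_ord0 /= add0r.
  rewrite (@sum_tail_mon c.+1 true); [|lia|lia|lia|lia].
  rewrite (@sum_tail_mon c.+1 false); [|lia|lia|lia|lia].
  rewrite -third_sum_step.
  move: (third_sum (1 + qvar) _ _ _ _) (third_sum 1 _ _ _ _) => S1 S0.
  rewrite mulrA qt_monM mulrDr mulrA; congr (_ * _ + _ * _).
    have -> : qvar = qt_mon 1 0 by rewrite /qt_mon expr0 mulr1.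
    by rewrite qt_monM; apply: qt_mon_congr; lia.
  by apply: qt_mon_congr; lia.
- rewrite mulr_sumr; apply: eq_bigr => e _; have e_lt := ltn_ord e.
  rewrite big_ord1 /= (@sum_tail_mon (v + e).+1 false); [|lia|lia|lia|lia].
  have -> : (v - (v + e).+1 = 0)%N by lia.
  by rewrite mulrA qt_monM; congr (_ * _); apply: qt_mon_congr; lia.
Qed.

End Tail.

(** * Filling stages for (k, l, l, l) and (l, l, l) *)

Lemma is_dyck4 k l a1 a2 a3 a4 : is_dyck [:: k; l; l; l] [:: a1; a2; a3; a4] =
  [&& a1 <= k, a1 + a2 <= k + l, a1 + a2 + a3 <= k + 2 * l
    & a1 + a2 + a3 + a4 == k + 3 * l]%N.
Proof. rewrite /is_dyck /=; lia. Qed.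

Lemma is_dyck3 l a2 a3 a4 : is_dyck [:: l; l; l] [:: a2; a3; a4] =
  [&& a2 <= l, a2 + a3 <= 2 * l & a2 + a3 + a4 == 3 * l]%N.
Proof. rewrite /is_dyck /=; lia. Qed.

(* [front2 i] is the abscissa of [P_i] as far as it is due to the first two
   columns, filled at stages 0 and [u]. *)
Section StageArithmetic.
Local Open Scope nat_scope.
Variables u v l : nat.

Let front2 i := minn (u + v) i + minn l (i - u).
(** For c, d <= l, [target2 c] and [target3 c d] are the abscissas of P_i at the stages i = u + c
    and i = u + c + d at which the last two columns are filled. *)
Let target2 c := u + minn v c + c.
Let target3 c d := target2 c + minn (v - c) d + minn (l - c) d + d.

Lemma front2_ge c i : c <= l -> u + c <= i -> target2 c <= front2 i.
Proof. rewrite /front2 /target2; lia. Qed.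

Lemma front2_lt c i : 0 < c -> i < u + c -> front2 i <= target2 c.-1.
Proof. rewrite /front2 /target2; lia. Qed.

Lemma front3_ge c d i : c <= l -> d <= l -> u + c + d <= i ->
  target3 c d <= front2 i + minn l (i - (u + c)).
Proof.
rewrite /front2 /target3 /target2 => cl dl le_i.
(* The comparison is made separately for the contributions of the first three columns. *)
have h1 : u + minn v c + minn (v - c) d <= minn (u + v) i by lia.
have h2 : c + minn (l - c) d <= minn l (i - u) by lia.
have h3 : d <= minn l (i - (u + c)) by lia.
move: h1 h2 h3; do 6!move: (minn _ _); lia.
Qed.

Lemma front3_lt c d i : c <= l -> 0 < d -> i < u + c + d ->
  front2 i + minn l (i - (u + c)) <= target3 c d.-1.
Proof.
rewrite /front2 /target3 /target2 => cl d_gt0 lt_i.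
have h1 : minn (u + v) i <= u + minn v c + minn (v - c) d.-1 by lia.
have h2 : minn l (i - u) <= c + minn (l - c) d.-1 by lia.
have h3 : minn l (i - (u + c)) <= d.-1 by lia.
move: h1 h2 h3; do 6!move: (minn _ _); lia.
Qed.

(** A column contributes 0 until it is filled, so whether P_i has reached the start of a north step
    depends only on the earlier columns, whose contributions are monotone in i. *)
Lemma stages_front c d A2 A3 i : c <= l -> d <= l -> u <= A2 <= A3 ->
    A2 <= target2 c -> (0 < c -> target2 c.-1 < A2) ->
    A3 <= target3 c d -> (0 < d -> target3 c d.-1 < A3) ->
    let front := front2 i + minn l (i - (u + c)) + minn l (i - (u + c + d)) in
  [/\ (u <= i) = (u <= front), (u + c <= i) = (A2 <= front)
    & (u + c + d <= i) = (A3 <= front)].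
Proof.
move=> cl dl uA A2c cA2 A3d dA3.
have lt_u : i < u -> front2 i < u by rewrite /front2; lia.
have lt_c : i < u + c -> front2 i < A2.
  case: (posnP c) => [-> | c_gt0 lt_i]; first by rewrite addn0 => /lt_u; lia.
  exact: leq_ltn_trans (front2_lt c_gt0 lt_i) (cA2 c_gt0).
have lt_d : i < u + c + d -> front2 i + minn l (i - (u + c)) < A3.
  case: (posnP d) => [-> | d_gt0 lt_i].
    by rewrite addn0 => lt_i; have := lt_c lt_i; lia.
  exact: leq_ltn_trans (front3_lt cl d_gt0 lt_i) (dA3 d_gt0).
have ge_c : u + c <= i -> A2 <= front2 i.
  by move=> le_i; apply: leq_trans A2c (front2_ge cl le_i).
have ge_d : u + c + d <= i -> A3 <= front2 i + minn l (i - (u + c)).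
  by move=> le_i; apply: leq_trans A3d (front3_ge cl dl le_i).
have ge_u : u <= i -> u <= front2 i by rewrite /front2; lia.
have m3 : i < u + c -> minn l (i - (u + c)) = 0 by lia.
have m4 : i < u + c + d -> minn l (i - (u + c + d)) = 0 by lia.
clear A2c cA2 A3d dA3.
move: (front2 i) (minn _ _) (minn _ _) lt_u lt_c lt_d ge_c ge_d ge_u m3 m4.
move=> f m n *; split; lia.
Qed.

End StageArithmetic.

Lemma bounce4 u v l c d A2 A3 : (0 < u + v <= l)%N ->
  (c <= l)%N -> (d <= l)%N ->
  (u <= A2 <= A3)%N -> (A2 <= u + minn v c + c)%N ->
  (0 < c -> u + minn v c.-1 + c.-1 < A2)%N ->
  (A3 <= u + minn v c + c + minn (v - c) d + minn (l - c) d + d)%N ->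
  (0 < d -> u + minn v c + c + minn (v - c) d.-1 + minn (l - c) d.-1 + d.-1
     < A3)%N ->
  bounce [:: u + v; l; l; l]%N [:: u; A2 - u; A3 - A2; u + v + 3 * l - A3]%N =
  (3 * u + 2 * c + d)%N.
Proof.
move=> uv_l cl dl uA A2c cA2 A3d dA3.
have A2_le : (A2 <= u + v + l)%N by clear cA2 A3d dA3; lia.
have A3_le : (A3 <= u + v + 2 * l)%N by clear cA2 A2c dA3; lia.
(* The first column alone advances one abscissa per stage, hence reaches u at stage u; the other two
   stages are read off from the intervals containing [A2] and [A3]. *)
rewrite (@bounceE _ _ [:: 0; u; u + c; u + c + d]%N) //=; first by lia.
- by lia.
- by rewrite is_dyck4; clear cA2 A2c A3d dA3; lia.
move=> i j; rewrite /bounce_abscissa unlock /=.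
have := stages_front i cl dl uA A2c cA2 A3d dA3; rewrite !subn0 !addn0 !addnA /=.
set X := (_ + minn l (i - (u + c + d)))%N; clearbody X; case=> uE cE dE.
clear cA2 A2c A3d dA3; case: j => [|[|[|[|j]]]] //= _ _; first by rewrite addn0 uE.
  by rewrite cE; congr leq; lia.
by rewrite dE; congr leq; lia.
Qed.

(** The case u = v = 0 of [stages_front], in which the first column contributes nothing. *)
Lemma bounce3 l c d A2 A3 : (0 < l)%N ->
  (c <= l)%N -> (d <= l)%N ->
  (A2 <= A3)%N -> (A2 <= c)%N ->
  (0 < c -> c.-1 < A2)%N ->
  (A3 <= c + minn (l - c) d + d)%N ->
  (0 < d -> c + minn (l - c) d.-1 + d.-1 < A3)%N ->
  bounce [:: l; l; l]%N [:: A2; A3 - A2; 3 * l - A3]%N = (2 * c + d)%N.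
Proof.
move=> l_gt0 cl dl A23 A2c cA2 A3d dA3.
have A3_le : (A3 <= 2 * l)%N by clear cA2 A2c dA3; lia.
rewrite (@bounceE _ _ [:: 0; c; c + d]%N) //=; first by lia.
- by lia.
- by rewrite is_dyck3; clear cA2 A3d dA3; lia.
move=> i j; rewrite /bounce_abscissa unlock /=.
have := @stages_front 0 0 l c d A2 A3 i cl dl.
rewrite !(add0n, sub0n, min0n, addn0).
move/(_ A23 A2c cA2 A3d dA3); rewrite !subn0 ?addn0 !addnA /=.
set X := (_ + minn l (i - (c + d)))%N; clearbody X; case=> _ cE dE.
clear cA2 A2c A3d dA3.
case: j => [|[|[|j]]] //= _ _; first by rewrite addn0 cE.
by rewrite dE; congr leq; lia.
Qed.

(** * Catalan numbers as sums of T(v, l) *)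

Definition qt_weight (ks a : seq nat) : qt_ring :=
  if is_dyck ks a then qt_mon (area ks a) (bounce ks a) else 0.

Lemma qt_catalanE ks : qt_catalan ks =
  \sum_(a : (size ks).-tuple 'I_(sumn ks).+1) qt_weight ks (map val a).
Proof. by rewrite /qt_catalan big_mkcond. Qed.

(** In terms of the abscissas u + a_2 and u + a_2 + a_3 the Dyck conditions become ranges of
    summation, and a_4 is determined by the total K. *)
Lemma sum_partial_sums (N u B2 B3 K : nat) (g : nat -> nat -> nat -> qt_ring) :
    (u <= B2 <= B3)%N -> (B3 <= K < N)%N ->
  \sum_(0 <= a2 < N) \sum_(0 <= a3 < N) \sum_(0 <= a4 < N)
    (if [&& u + a2 <= B2, u + a2 + a3 <= B3 & u + a2 + a3 + a4 == K]%N
     then g a2 a3 a4 else 0) =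
  \sum_(u <= A2 < B2.+1) \sum_(A2 <= A3 < B3.+1)
    g (A2 - u)%N (A3 - A2)%N (K - A3)%N.
Proof.
move=> uB BK; rewrite -(@sum_nat_shift _ N); [|lia|lia].
apply: eq_big_nat => a2 _; case: ifP => [le_2 | _]; last first.
  by rewrite big1 // => a3 _; rewrite big1.
rewrite -(@sum_nat_shift _ N); [|lia|lia].
apply: eq_big_nat => a3 _; case: ifP => [le_3 | _]; last by rewrite big1.
by rewrite (sum_nat_pick (fun i => g a2 a3 i)) ?addKn //; lia.
Qed.

Lemma sum_tuple3 N (G : seq nat -> qt_ring) :
  \sum_(a : 3.-tuple 'I_N) G (map val a) =
  \sum_(0 <= a1 < N) \sum_(0 <= a2 < N) \sum_(0 <= a3 < N) G [:: a1; a2; a3].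
Proof.
rewrite sum_tuple_cons; apply: eq_bigr => a1 _.
rewrite (sum_tuple_cons _ _ (fun s => G (a1 :: s))); apply: eq_bigr => a2 _.
rewrite (sum_tuple_cons _ _ (fun s => G [:: a1, a2 & s])).
apply: eq_bigr => a3 _.
by rewrite (sum_tuple_nil _ (fun s => G [:: a1, a2, a3 & s])).
Qed.

(** Here u = a_1 is the filling stage of the second column; it delays all three later columns,
    whence the factor t^(3u). *)
Lemma qt_catalan4E k l : (0 < k <= l)%N ->
  qt_catalan [:: k; l; l; l] =
  \sum_(u < k.+1) qt_mon 0 (3 * u) * second_sum (k - u) l.
Proof.
move=> kl; rewrite qt_catalanE /= sum_tuple_cons.
set N := (k + _).+1; set W := qt_weight _.
have le_kN : (k < N)%N by rewrite /N; lia.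
rewrite -[RHS](big_mkord xpredT
  (fun u => qt_mon 0 (3 * u) * second_sum (k - u) l)) -(@sum_nat_shift _ N 0 k) //.
apply: eq_big_nat => u _; rewrite add0n (sum_tuple3 _ (fun s => W (u :: s))).
case: (leqP u k) => [le_uk | lt_ku]; last first.
  rewrite big1 // => a2 _; rewrite big1 // => a3 _; rewrite big1 // => a4 _.
  by rewrite /W /qt_weight is_dyck4 leqNgt lt_ku.
pose g a2 a3 a4 : qt_ring := qt_mon (area [:: k; l; l; l] [:: u; a2; a3; a4])
  (bounce [:: k; l; l; l] [:: u; a2; a3; a4]).
pose K := (k + 3 * l)%N.
transitivity (\sum_(0 <= a2 < N) \sum_(0 <= a3 < N) \sum_(0 <= a4 < N)
    (if [&& u + a2 <= k + l, u + a2 + a3 <= k + 2 * l & u + a2 + a3 + a4 == K]%N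
     then g a2 a3 a4 else 0)).
  apply: eq_bigr => a2 _; apply: eq_bigr => a3 _; apply: eq_bigr => a4 _.
  by rewrite /W /qt_weight is_dyck4 le_uk.
rewrite sum_partial_sums; [|lia|by rewrite /K /N; lia].
have kE : k = (u + (k - u))%N by rewrite subnKC.
rewrite -(@sum_tail u (k - u) l
  (fun A2 A3 => bounce [:: k; l; l; l] [:: u; A2 - u; A3 - A2; K - A3]%N)).
- rewrite -kE; apply: eq_big_nat => A2 A2_lt; apply: eq_big_nat => A3 A3_lt.
  by apply: qt_mon_congr => //; rewrite /area /red_rank /=; lia.
- by lia.
- move=> c d A2 A3 cl dl uA A2c cA2 A3d dA3; rewrite /K.
  have := @bounce4 u (k - u) l c d A2 A3; rewrite -kE; apply => //.
Qed.

Lemma qt_catalan3E l : (0 < l)%N -> qt_catalan [:: l; l; l] = second_sum 0 l.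
Proof.
move=> l_gt0; rewrite qt_catalanE /= sum_tuple3.
set N := (l + _).+1; set W := qt_weight _.
pose g a2 a3 a4 : qt_ring := qt_mon (area [:: l; l; l] [:: a2; a3; a4])
  (bounce [:: l; l; l] [:: a2; a3; a4]).
transitivity (\sum_(0 <= a2 < N) \sum_(0 <= a3 < N) \sum_(0 <= a4 < N)
    (if [&& 0 + a2 <= l, 0 + a2 + a3 <= 2 * l & 0 + a2 + a3 + a4 == 3 * l]%N
     then g a2 a3 a4 else 0)).
  apply: eq_bigr => a2 _; apply: eq_bigr => a3 _; apply: eq_bigr => a4 _.
  by rewrite /W /qt_weight is_dyck3 add0n.
rewrite sum_partial_sums; [|lia|by rewrite /N; lia].
have <- : qt_mon 0 (3 * 0) * second_sum 0 l = second_sum 0 l.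
  by rewrite /qt_mon !expr0 !mul1r.
rewrite -(@sum_tail 0 0 l
  (fun A2 A3 => bounce [:: l; l; l] [:: A2; A3 - A2; 3 * l - A3]%N)) //.
- rewrite !add0n; apply: eq_big_nat => A2 A2_lt; apply: eq_big_nat => A3 A3_lt.
  by rewrite /g subn0; apply: qt_mon_congr => //; rewrite /area /red_rank /=; lia.
- move=> c d A2 A3 cl dl uA; rewrite !(add0n, sub0n, min0n, addn0) => *.
  by apply: bounce3; rewrite // ?(andP uA).2 //; lia.
Qed.

(** The conventions for k = 0 fit the formula: the sum reduces to T(0, m), which is C_(m,m,m) for m
    > 0 and 1 for m = 0. *)
Lemma qt_catalan4_second_sum k m : qt_catalan4 k m =
  \sum_(u < k.+1) qt_mon 0 (3 * u) * second_sum (k - u) (k + m).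
Proof.
case: k m => [|k] m; last by rewrite /= -qt_catalan4E //; lia.
rewrite big_ord1 subnn add0n {1}/qt_mon !expr0 !mul1r.
case: m => [|m]; last exact: qt_catalan3E.
rewrite /second_sum /third_sum !big_ord0 !mulr0 !addr0 mul1r.
by rewrite /qt_mon !expr0 !mul1r.
Qed.

(** * The functional equation and the closed form *)

Lemma qt_catalan4_0 m : qt_catalan4 0 m = second_sum 0 m.
Proof.
by rewrite qt_catalan4_second_sum big_ord1 /qt_mon !expr0 !mul1r.
Qed.

(** The term u = 0 splits off; in the others u drops by one while l = (k + 1) + m = k + (m + 1) is
    kept. This is the recursion solved by [fps2_eq_rec]. *)
Lemma qt_catalan4S k m : qt_catalan4 k.+1 m =
  qt_mon 0 3 * qt_catalan4 k m.+1 + second_sum k.+1 (k.+1 + m).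
Proof.
rewrite !qt_catalan4_second_sum big_ord_recl addrC subn0; congr (_ + _); last first.
  by rewrite /qt_mon !expr0 !mul1r.
rewrite mulr_sumr; apply: eq_bigr => u _.
rewrite mulrA qt_monM addnS addSn subSS.
by congr (qt_mon _ _ * _); rewrite lift0 mulnS.
Qed.

(** Clears the denominators of G with the factors kept as opaque units. The factor [a2] comes from
    the denominator 1 - x t^6 of H, which does not occur in G. *)
Lemma gf_clear_denominators (R : comUnitRingType)
    (x y a1 a2 a3 a4 a5 b1 b2 b3 b4 c31 c11 c22 s cs31 cs11 c13 c12 c03 c15 : R) :
    all (fun z => z \is a GRing.unit) [:: a1; a3; a4; a5; b1; b2; b3; b4] ->
  a1 * a2 * a3 * a4 * a5 * b1 * b2 * b3 * b4 *
  (a1^-1 / b1 + c31 * (x * (a1^-1 / b1 / a3)) + c11 * (y * (a3^-1 / b1 / b3))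
   + (c22 * (x * ((s * (a1^-1 / b1) + cs31 * (x * (a1^-1 / b1 / a3))
                   + cs11 * (y * (a3^-1 / b1 / b3))) / a5))
      + c13 * (x * (a5^-1 / b3 / a4 / a3)))
   + (c12 * (y * ((a5^-1 / b1 + c11 * (y * (a5^-1 / b1 / b3))) / b4))
      + c03 * (y * (a5^-1 / b3 / a4 / b2))
      + c15 * (y * (y * (a5^-1 / b4 / b2) / b3)))) =
  a2 * a4 * b2 * b4 * (a3 * a5 * b3 + c31 * x * a5 * b3 + c11 * y * a1 * a5)
  + a2 * a4 * b2 * b4 * c22 * x * (s * a3 * b3 + cs31 * x * b3 + cs11 * y * a1)
  + c13 * x * a1 * a2 * b1 * b2 * b4
  + a1 * a2 * a3 * a4 * b2 * c12 * y * (b3 + c11 * y)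
  + c03 * y * a1 * a2 * a3 * b1 * b4
  + c15 * y^+2 * a1 * a2 * a3 * a4 * b1.
Proof.
case/and5P => a1U a3U a4U a5U /and5P[b1U b2U b3U b4U _].
have [V1 V3 V4 V5] := And4 (divrr a1U) (divrr a3U) (divrr a4U) (divrr a5U).
have [W1 W2 W3 W4] := And4 (divrr b1U) (divrr b2U) (divrr b3U) (divrr b4U).
move: (a1^-1) (a3^-1) (a4^-1) (a5^-1) (b1^-1) (b2^-1) (b3^-1) (b4^-1)
  V1 V3 V4 V5 W1 W2 W3 W4 => i1 i3 i4 i5 j1 j2 j3 j4 V1 V3 V4 V5 W1 W2 W3 W4.
(* Each inverse is grouped with its factor, so that rewriting z z^-1 = 1 leaves a polynomial. *)
transitivity (
  a2 * a4 * b2 * b4 * ((a1 * i1) * (b1 * j1) * a3 * a5 * b3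
    + c31 * x * ((a1 * i1) * (b1 * j1) * (a3 * i3)) * a5 * b3
    + c11 * y * ((a3 * i3) * (b1 * j1) * (b3 * j3)) * a1 * a5)
  + a2 * a4 * b2 * b4 * c22 * x * (a5 * i5)
    * (s * ((a1 * i1) * (b1 * j1)) * a3 * b3
       + cs31 * x * ((a1 * i1) * (b1 * j1) * (a3 * i3)) * b3
       + cs11 * y * ((a3 * i3) * (b1 * j1) * (b3 * j3)) * a1)
  + c13 * x * ((a5 * i5) * (b3 * j3) * (a4 * i4) * (a3 * i3))
    * a1 * a2 * b1 * b2 * b4
  + a1 * a2 * a3 * a4 * b2 * c12 * y * (b4 * j4)
    * ((a5 * i5) * (b1 * j1) * b3
       + c11 * y * ((a5 * i5) * (b1 * j1) * (b3 * j3)))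
  + c03 * y * ((a5 * i5) * (b3 * j3) * (a4 * i4) * (b2 * j2))
    * a1 * a2 * a3 * b1 * b4
  + c15 * y^+2 * ((a5 * i5) * (b4 * j4) * (b2 * j2) * (b3 * j3))
    * a1 * a2 * a3 * a4 * b1); first by ring.
by rewrite V1 V3 V4 V5 W1 W2 W3 W4; ring.
Qed.

(** The functional equation multiplied by the denominator of H and by [b4] = 1 - y q t^2, a factor
    that occurs in G but cancels in H. *)
Lemma gf_numerator (x y q t : fps2 qt_ring) :
  let a1 := 1 - x * q^+6 in let a2 := 1 - x * t^+6 in
  let a3 := 1 - x * q^+3 * t in let a4 := 1 - x * q * t^+3 in
  let a5 := 1 - x * q^+2 * t^+2 in
  let b1 := 1 - y * q^+3 in let b2 := 1 - y * t^+3 in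
  let b3 := 1 - y * q * t in let b4 := 1 - y * q * t^+2 in
  let s := 1 + q + q^+2 in let w := 1 + q in
  (y - t^+3 * x) * - M x y q t * b4 =
  y * (a2 * a4 * b2 * b4 * (a3 * a5 * b3 + s * (q^+3 * t) * x * a5 * b3
         + w * (q * t) * y * a1 * a5)
       + a2 * a4 * b2 * b4 * (q^+2 * t^+2) * x
         * (s * a3 * b3 + w * s * (q^+3 * t) * x * b3 + w^+2 * (q * t) * y * a1)
       + w * (q * t^+3) * x * a1 * a2 * b1 * b2 * b4
       + a1 * a2 * a3 * a4 * b2 * (q * t^+2) * y * (b3 + w * (q * t) * y)
       + t^+3 * y * a1 * a2 * a3 * b1 * b4
       + q * t^+5 * y^+2 * a1 * a2 * a3 * a4 * b1)
  - x * (t^+3 * - M x 0 q t) * (b1 * b2 * b3 * b4).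
Proof. by rewrite /M /=; ring. Qed.

Lemma no_y_M0 : no_y (M (fps2X qt_ring) 0 (fps2C qvar) (fps2C tvar)).
Proof.
have no_y_nat n : no_y (n%:R : fps2 qt_ring).
  by rewrite -(rmorph_nat (@fps2C qt_ring)); apply: no_y_C.
rewrite /M; repeat match goal with
  | |- no_y (_ + _) => apply: no_yD
  | |- no_y (- _) => apply: no_yN
  | |- no_y (_ * _) => apply: no_yM
  | |- no_y (_ ^+ _) => apply: no_yX
  | |- no_y (fps2C _) => apply: no_y_C
  | |- no_y (fps2X _) => apply: no_y_X
  | |- no_y 0 => exact: (no_y_nat 0%N)
  | |- no_y 1 => exact: (no_y_nat 1%N)
  | |- no_y _ => exact: no_y_nat
  end.
Qed.

Theorem theorem5p2 :
  let x : fps2 qt_ring := fps2X qt_ring in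
  let y : fps2 qt_ring := fps2Y qt_ring in
  let q : fps2 qt_ring := fps2C qvar in
  let t : fps2 qt_ring := fps2C tvar in
  H = - M x y q t
      / ((1 - x * q^+6) * (1 - x * t^+6) * (1 - x * q^+3 * t)
         * (1 - x * q * t^+3) * (1 - x * q^+2 * t^+2)
         * (1 - y * q^+3) * (1 - y * t^+3) * (1 - y * q * t)).
Proof.
move=> x y q t.
have CE a b : fps2C (qt_mon a b) = q ^+ a * t ^+ b by rewrite rmorphM !rmorphXn.
pose a1 := 1 - x * fps2C (qt_mon 6 0); pose a2 := 1 - x * fps2C (qt_mon 0 6).
pose a3 := 1 - x * fps2C (qt_mon 3 1); pose a4 := 1 - x * fps2C (qt_mon 1 3).
pose a5 := 1 - x * fps2C (qt_mon 2 2); pose b1 := 1 - y * fps2C (qt_mon 3 0).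
pose b2 := 1 - y * fps2C (qt_mon 0 3); pose b3 := 1 - y * fps2C (qt_mon 1 1).
pose b4 := 1 - y * fps2C (qt_mon 1 2).
have a1E : 1 - x * q ^+ 6 = a1 by rewrite /a1 CE; ring.
have a2E : 1 - x * t ^+ 6 = a2 by rewrite /a2 CE; ring.
have a3E : 1 - x * q ^+ 3 * t = a3 by rewrite /a3 CE; ring.
have a4E : 1 - x * q * t ^+ 3 = a4 by rewrite /a4 CE; ring.
have a5E : 1 - x * q ^+ 2 * t ^+ 2 = a5 by rewrite /a5 CE; ring.
have b1E : 1 - y * q ^+ 3 = b1 by rewrite /b1 CE; ring.
have b2E : 1 - y * t ^+ 3 = b2 by rewrite /b2 CE; ring.
have b3E : 1 - y * q * t = b3 by rewrite /b3 CE; ring.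
have b4E : 1 - y * q * t ^+ 2 = b4 by rewrite /b4 CE; ring.
have numE := gf_numerator x y q t; lazy zeta in numE.
rewrite a1E a2E a3E a4E a5E b1E b2E b3E b4E in numE.
rewrite a1E a2E a3E a4E a5E b1E b2E b3E.
have [a1U a2U a3U a4U] : [/\ a1 \is a GRing.unit, a2 \is a GRing.unit,
    a3 \is a GRing.unit & a4 \is a GRing.unit] by split; apply: unit_subX.
have a5U : a5 \is a GRing.unit by apply: unit_subX.
have [b1U b2U b3U b4U] : [/\ b1 \is a GRing.unit, b2 \is a GRing.unit,
    b3 \is a GRing.unit & b4 \is a GRing.unit] by split; apply: unit_subY.
(* The closed form of t^3 H(x, 0): at y = 0 the factors [b1], [b2], [b3] become 1. *)
pose h := fps2C (qt_mon 0 3) * - M x 0 q t / a1 / a2 / a3 / a4 / a5.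
have hy : no_y h.
  by do 5!apply: no_y_geoX; apply/no_yM/no_yN/no_y_M0/no_y_C.
apply: fps2P => k m; apply/esym.
apply: (fps2_eq_rec (f := gf_low + gf_mid + gf_high) (a := qt_mon 0 3) hy).
- set D := a1 * a2 * a3 * a4 * a5 * b1 * b2 * b3.
  have DU : D \is a GRing.unit.
    by rewrite (unitrMl _ b3U) (unitrMl _ b2U) (unitrMl _ b1U) (unitrMl _ a5U)
      (unitrMl _ a4U) (unitrMl _ a3U) (unitrMl _ a2U).
  have UU : D * b4 \is a GRing.unit by rewrite unitrM DU.
  apply: (mulrI UU); rewrite [RHS]mulrBr.
  have -> : D * b4 * ((y - fps2C (qt_mon 0 3) * x) * (- M x y q t / D)) =
      (y - t ^+ 3 * x) * - M x y q t * b4.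
    rewrite CE -[in RHS](divrK DU (- M x y q t)); ring.
  have -> : D * b4 * (x * h) = x * (t ^+ 3 * - M x 0 q t) * (b1 * b2 * b3 * b4).
    have hE : h * a5 * a4 * a3 * a2 * a1 = t ^+ 3 * - M x 0 q t.
      rewrite /h (divrK a5U) (divrK a4U) (divrK a3U) (divrK a2U) (divrK a1U).
      by rewrite CE mul1r.
    by rewrite -hE /D; ring.
  rewrite numE; congr (_ - _); rewrite [RHS]mulrCA; congr (_ * _).
  rewrite /D /gf_low /gf_mid /gf_high.
  (* G rewritten in the abbreviated factors, to match [gf_clear_denominators]. *)
  transitivity (a1 * a2 * a3 * a4 * a5 * b1 * b2 * b3 * b4 *
    (a1^-1 / b1
     + fps2C (qt3 * qt_mon 3 1) * (x * (a1^-1 / b1 / a3))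
     + fps2C ((1 + qvar) * qt_mon 1 1) * (y * (a3^-1 / b1 / b3))
     + (fps2C (qt_mon 2 2) * (x * ((fps2C qt3 * (a1^-1 / b1)
          + fps2C ((1 + qvar) * qt3 * qt_mon 3 1) * (x * (a1^-1 / b1 / a3))
          + fps2C ((1 + qvar) ^+ 2 * qt_mon 1 1) * (y * (a3^-1 / b1 / b3)))
          / a5))
        + fps2C ((1 + qvar) * qt_mon 1 3) * (x * (a5^-1 / b3 / a4 / a3)))
     + (fps2C (qt_mon 1 2) * (y * ((a5^-1 / b1
          + fps2C ((1 + qvar) * qt_mon 1 1) * (y * (a5^-1 / b1 / b3))) / b4))
        + fps2C (qt_mon 0 3) * (y * (a5^-1 / b3 / a4 / b2))
        + fps2C (qt_mon 1 5) * (y * (y * (a5^-1 / b4 / b2) / b3))))); last by [].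
  rewrite [RHS]gf_clear_denominators; last by rewrite /= a1U a3U a4U a5U b1U b2U b3U b4U.
  have sE : fps2C qt3 = 1 + q + q ^+ 2 by rewrite !rmorphD rmorph1 rmorphXn.
  have wE : fps2C (1 + qvar) = 1 + q by rewrite rmorphD rmorph1.
  have cM c a b : fps2C (c * qt_mon a b) = fps2C c * (q ^+ a * t ^+ b).
    by rewrite -CE; exact: rmorphM.
  rewrite (cM qt3) !(cM (1 + qvar) 1) (cM ((1 + qvar) * qt3)) (cM ((1 + qvar) ^+ 2)).
  rewrite (rmorphM _ (1 + qvar)) (rmorphXn _ 2 (1 + qvar)) /= sE wE.
  rewrite !CE; clear -x y q t; clearbody a1 a2 a3 a4 a5 b1 b2 b3 b4 x y q t.
  ring.
- by move=> m'; rewrite coef_gf; apply: qt_catalan4_0.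
- by move=> k' m'; rewrite coef_gf; apply: qt_catalan4S.
Qed.
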